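(* For every number of candidates $m\ge 2$ and every $\beta\ge 1$, the utilitarian distortion of the Borda rule under the Plackett–Luce model with parameter $\beta$ satisfies $$\mathcal{D}_{m,\beta}(\mathrm{Borda})\;\le\;\beta\,\frac{1+e^{-\beta}}{1-e^{-\beta}}.$$
   Context: Setting. $C$ is a set of $m$ candidates and $\beta\ge 1$ is a real parameter. Let $\mathcal{V}$ be a probability distribution on $[0,1]^C$ (utility vectors). For each $n$, the utility vectors $\mathbf{u}_1,\dots,\mathbf{u}_n$ of $n$ voters are drawn i.i.d. from $\mathcal{V}$, with $u_{i,j}\in[0,1]$ the utility of voter $i$ for candidate $j$. Given the utilities, each voter $i$ independently submits a random ranking $\pi_i$ of $C$ drawn from the Plackett–Luce model: positions are filled from top to bottom, and at each step a candidate $j$ is chosen among the not yet ranked candidates with probability proportional to $e^{\beta u_{i,j}}$. A voting rule $f$ maps each profile $\pi^n=(\pi_1,\dots,\pi_n)$ (for every $n$) to a probability distribution over $C$; it is deterministic if it always selects a single winner. Put $\mathrm{Util}_j=\mathbb{E}_{\mathbf{u}\sim\mathcal{V}}[u_j]$ and $\mathrm{Util}_n(f)=\mathbb{E}\big[\tfrac1n\sum_{i=1}^n u_{i,f(\pi^n)}\big]$, the expectation being over utilities, rankings and any internal randomness of $f$. The utilitarian distortion is $$\mathcal{D}_{m,\beta}(f)=\sup_{\mathcal{V}}\ \limsup_{n\to\infty}\ \frac{\max_{j\in C}\mathrm{Util}_j}{\mathrm{Util}_n(f)},$$ with the ratio taken to be $1$ if numerator and denominator are both $0$. Borda rule. Let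 $s_{j,j'}$ be the fraction of voters ranking $j$ above $j'$. The Borda score of $j$ is $n\sum_{j'\neq j}s_{j,j'}$; the rule selects a candidate of maximum Borda score (ties broken by an arbitrary fixed rule). *)

(* Defs.v *)
From HB Require Import structures.
From mathcomp Require Import all_boot all_order all_algebra all_fingroup.
From mathcomp Require Import all_classical all_reals all_analysis.

Set Implicit Arguments.
Unset Strict Implicit.
Unset Printing Implicit Defensive.

Import Order.TTheory GRing.Theory Num.Theory.
Import numFieldNormedType.Exports.

Local Open Scope classical_set_scope.
Local Open Scope ring_scope.

Section iid.
Context {d : measure_display} {T : measurableType d} {R : realType}.

Definition tuple_cons n (x : T * n.-tuple T) : n.+1.-tuple T :=
  [tuple of x.1 :: x.2].

Lemma measurable_tuple_cons n : measurable_fun [set: T * n.-tuple T] (@tuple_cons n).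
Proof. by apply: measurable_cons. Qed.

HB.instance Definition _ n :=
  isMeasurableFun.Build _ _ _ _ (@tuple_cons n) (@measurable_tuple_cons n).

(* The n-fold product measure, i.e. the law of n i.i.d. draws from V. *)
Fixpoint iid (V : probability T R) (n : nat) : probability (n.-tuple T) R :=
  match n with
  | 0%N => dirac ([tuple] : 0.-tuple T)
  | n'.+1 => distribution (V \x iid V n')%E (@tuple_cons n')
  end.

End iid.

(* The candidates are the elements of 'I_m.  A ranking is a permutation
   pi : 'S_m with pi k the candidate at position k, position 0 being the top.
   A utility vector is a u : m.-tuple R, with tnth u j the utility of j. *)
Section rankings.
Context {R : realType} {m : nat}.

Definition rank_of (pi : 'S_m) (j : 'I_m) : 'I_m := (pi^-1)%g j.

Definition ranks_above (pi : 'S_m) (j j' : 'I_m) : bool :=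
  (rank_of pi j < rank_of pi j')%N.

(* Probability of pi when positions k = 0, 1, 2, and so on are filled in turn,
   the candidate at k being drawn with weight expR (beta * u_c) among the
   candidates c not placed at an earlier position. *)
Definition plackett_luce (beta : R) (u : m.-tuple R) (pi : 'S_m) : R :=
  \prod_(k < m) (expR (beta * tnth u (pi k)) /
    \sum_(c : 'I_m | (k <= rank_of pi c)%N) expR (beta * tnth u c)).

(* Conditional probability of the profile P given the utilities us. *)
Definition profile_prob (beta : R) n (us : n.-tuple (m.-tuple R))
    (P : n.-tuple 'S_m) : R :=
  \prod_(i < n) plackett_luce beta (tnth us i) (tnth P i).

End rankings.

Record lottery (R : realType) (m : nat) := Lottery {
  lottery_prob :> 'I_m -> R;
  lottery_ge0 : forall j, 0 <= lottery_prob j;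
  lottery_sum1 : \sum_(j < m) lottery_prob j = 1 }.

Section sure_lottery.
Context (R : realType) (m : nat) (w : 'I_m).

Let sure_prob (j : 'I_m) : R := (j == w)%:R.

Let sure_ge0 j : 0 <= sure_prob j. Proof. exact: ler0n. Qed.

Let sure_sum1 : \sum_(j < m) sure_prob j = 1.
Proof.
by rewrite (bigD1 w)//= /sure_prob eqxx big1 ?addr0// => j /negbTE ->.
Qed.

Definition sure : lottery R m := Lottery sure_ge0 sure_sum1.

End sure_lottery.

Definition voting_rule (R : realType) (m : nat) :=
  forall n : nat, n.-tuple 'S_m -> lottery R m.

Section distortion.
Context {R : realType} {m : nat}.

Definition utility_distribution (V : probability (m.-tuple R) R) : Prop :=
  V [set u | forall j, 0 <= tnth u j <= 1] = 1%E.

Definition Util (V : probability (m.-tuple R) R) (j : 'I_m) : \bar R :=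
  'E_V[fun u => tnth u j].

(* The expectation over the utilities is the integral against iid V n; those
   over the rankings given the utilities, and over the choice of the winner
   given the rankings, are finite sums. *)
Definition Util_rule (beta : R) (V : probability (m.-tuple R) R)
    (f : voting_rule R m) (n : nat) : \bar R :=
  'E_(iid V n)[fun us : n.-tuple (m.-tuple R) =>
    \sum_(P : n.-tuple 'S_m) profile_prob beta us P *
      \sum_(j < m) f n P j * (n%:R^-1 * \sum_(i < n) tnth (tnth us i) j)].

(* In \bar R, x / 0 = +oo for x > 0, whereas 0 / 0 would be 0. *)
Definition utility_ratio (x y : \bar R) : \bar R :=
  if (x == 0%E) && (y == 0%E) then 1%E else (x / y)%E.

Definition distortion (beta : R) (f : voting_rule R m) : \bar R :=
  ereal_sup [set limn_esup (fun n =>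
      utility_ratio (\big[maxe/-oo%E]_(j < m) Util V j) (Util_rule beta V f n))
    | V in utility_distribution].

End distortion.

Section borda.
Context (R : realType) {m : nat}.

Definition fraction_above n (P : n.-tuple 'S_m) (j j' : 'I_m) : R :=
  #|[pred i : 'I_n | ranks_above (tnth P i) j j']|%:R / n%:R.

Definition borda_score n (P : n.-tuple 'S_m) (j : 'I_m) : R :=
  n%:R * \sum_(j' < m | j' != j) fraction_above P j j'.

Definition borda_winners n (P : n.-tuple 'S_m) : {set 'I_m} :=
  [set j | [forall k, borda_score P k <= borda_score P j]].

(* A tie-breaking rule may depend on the profile as well as on the set of tied
   candidates. *)
Definition tie_breaking :=
  forall n : nat, n.-tuple 'S_m -> {set 'I_m} -> 'I_m.

Definition valid_tie_breaking (t : tie_breaking) : Prop :=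
  forall n (P : n.-tuple 'S_m) (S : {set 'I_m}), S != finset.set0 -> t n P S \in S.

Definition borda (t : tie_breaking) : voting_rule R m :=
  fun n P => sure R (t n P (borda_winners P)).

End borda.

(* Main.v *)
Require Import Defs.
From mathcomp Require Import all_boot all_order all_algebra all_fingroup.
From mathcomp Require Import all_classical all_reals all_analysis.
From mathcomp Require Import measurable_realfun ring lra.

(** Write [s] for the logistic function [s x = 1 / (1 + exp (- beta x))], so that
    a Plackett-Luce voter ranks [j] above [k] with probability [s (u_j - u_k)],
    and put [c1 = s 1 - 1/2] and [c2 = beta / 4]; the claimed bound is
    [2 c2 / c1].  For [x, y, z] in [[0, 1]] one has
      [s (x - z) - s (y - z) >= c1 (x - z) - c2 y]  and
      [1/2 - s (y - z) >= c1 z - c2 y].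
    Let [w] have the largest expected Borda score.  Taking [x = u_j], [y = u_w],
    [z = u_k] and averaging over the voters and over [k], the first inequality
    gives [c1 (U_j - Ubar) <= c2 U_w], as [w] scores at least as much as [j], and
    the second one gives [c1 Ubar <= c2 U_w], as [w] scores at least as much as
    the average candidate; hence [c1 U_j <= 2 c2 U_w].  The actual Borda winner
    depends on the profile, but given the utilities the rankings are independent,
    so the scores (divided by [n]) deviate from their conditional means by
    [O(1 / sqrt n)] in expectation, and the argument survives with an error of
    that order before the utilities are integrated out. *)

Set Implicit Arguments.
Unset Strict Implicit.
Unset Printing Implicit Defensive.

Import Order.TTheory GRing.Theory Num.Theory.
Import numFieldNormedType.Exports.

Local Open Scope classical_set_scope.
Local Open Scope ring_scope.

(** * Monotonicity, Lipschitz and chord bounds for the logistic function *)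

Section logistic.
Context {R : realType}.
Implicit Types b x y z : R.

Definition logistic b x : R := (1 + expR (- (b * x)))^-1.

Lemma logistic_den_gt0 b x : 0 < 1 + expR (- (b * x)).
Proof. by rewrite addr_gt0// expR_gt0. Qed.

Lemma logisticN b x : logistic b (- x) = 1 - logistic b x.
Proof.
rewrite /logistic mulrN opprK expRN.
have e0 := expR_gt0 (b * x); field.
by rewrite !lt0r_neq0// ?addr_gt0// ?invr_gt0.
Qed.

Lemma logistic0 b : logistic b 0 = 2^-1.
Proof. by rewrite /logistic mulr0 oppr0 expR0. Qed.

Lemma logistic_gt0 b x : 0 < logistic b x.
Proof. by rewrite invr_gt0 logistic_den_gt0. Qed.

Lemma logistic_lt1 b x : logistic b x < 1.
Proof. by have := logistic_gt0 b (- x); rewrite logisticN subr_gt0. Qed.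

Lemma logistic_homo b : 0 <= b -> {homo logistic b : x y / x <= y}.
Proof.
move=> b0 x y xy; rewrite lef_pV2 ?posrE ?logistic_den_gt0//.
by rewrite lerD2l ler_expR lerN2 ler_wpM2l.
Qed.

(** Writing the slope through the value [s] as [b s (1 - s)] lets bounds on slopes be read off from
    bounds on [s]. *)
Lemma is_derive_logistic b x :
  is_derive x 1 (logistic b) (b * (logistic b x * (1 - logistic b x))).
Proof.
have D : is_derive x 1 (fun y => 1 + expR (- (b * y))) (- b * expR (- (b * x))).
  apply: is_derive_eq.
  rewrite add0r /GRing.scale /=; ring.
have n0 : 1 + expR (- (b * x)) != 0 by rewrite lt0r_neq0// logistic_den_gt0.
have := is_deriveV (f := fun y => 1 + expR (- (b * y))) n0 D.
move=> H; apply: is_derive_eq.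
rewrite /GRing.scale /= /logistic; field; exact: n0.
Qed.

Lemma continuous_logistic b : continuous (logistic b).
Proof.
by move=> x; apply/differentiable_continuous/derivable1_diffP;
  case: (is_derive_logistic b x).
Qed.

Lemma logistic_MVT b x y : x < y -> exists2 c, x < c < y &
  logistic b y - logistic b x = b * (logistic b c * (1 - logistic b c)) * (y - x).
Proof.
move=> xy; have [c] := MVT xy (fun z _ => is_derive_logistic b z)
  (continuous_subspaceT (@continuous_logistic b)).
by rewrite in_itv /= => cxy ->; exists c.
Qed.

(** The slope [b s (1 - s)] never exceeds [b / 4], because [(s - 1/2)^2 >= 0]. *)
Lemma logistic_lipschitz b x y : 0 <= b -> x <= y ->
  logistic b y - logistic b x <= b / 4 * (y - x).
Proof.
move=> b0; rewrite le_eqVlt => /predU1P[->|xy]; first by rewrite !subrr mulr0.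
have [c _ ->] := logistic_MVT b xy.
rewrite ler_wpM2r ?subr_ge0 ?(ltW xy)// ler_wpM2l//.
have := sqr_ge0 (logistic b c - 2^-1); nra.
Qed.

(* Concavity on [0, 1]: [s (1 - s)] decreases as [s] grows beyond 1/2, so a
   chord point below the segment would contradict the mean value theorem. *)
Lemma logistic_chord b x : 0 <= b -> 0 <= x <= 1 ->
  x * (logistic b 1 - 2^-1) <= logistic b x - 2^-1.
Proof.
move=> b0 /andP[]; rewrite le_eqVlt => /predU1P[<- _|x0].
  by rewrite logistic0 mul0r subrr.
rewrite le_eqVlt => /predU1P[->|x1]; first by rewrite mul1r.
have [p /andP[p0 px]] := logistic_MVT b x0.
have [q /andP[xq q1]] := logistic_MVT b x1.
have pq : p <= q by lra.
have := logistic_homo b0 (ltW p0); have := logistic_homo b0 pq.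
rewrite logistic0 subr0.
move: (logistic b x) (logistic b 1) (logistic b p) (logistic b q) => s s1 sp sq.
move=> spq sp2 e1 e0.
have K : 0 <= b * (sp * (1 - sp) - sq * (1 - sq)) by rewrite mulr_ge0//; nra.
have : 0 <= (x * (1 - x)) * (b * (sp * (1 - sp) - sq * (1 - sq))).
  by rewrite mulr_ge0// mulr_ge0; lra.
have -> : x * (1 - x) * (b * (sp * (1 - sp) - sq * (1 - sq))) =
  (1 - x) * (b * (sp * (1 - sp)) * x) - x * (b * (sq * (1 - sq)) * (1 - x)) by ring.
rewrite -e0 -e1; lra.
Qed.

(** Split at [x = z]. If [x <= z], the term in [x - z] is nonpositive and [s] gains at most
    [b / 4 * y] from [x - z] to [y - z]. If [z < x], both values are compared with [s 0 = 1/2]: the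
    chord bound serves for [x - z], monotonicity or the Lipschitz bound for [y - z]. *)
Lemma logistic_sub_ge b x y z : 0 <= b -> 0 <= x <= 1 -> 0 <= y <= 1 ->
  0 <= z <= 1 ->
  (logistic b 1 - 2^-1) * (x - z) - b / 4 * y <=
  logistic b (x - z) - logistic b (y - z).
Proof.
move=> b0 /andP[x0 x1] /andP[y0 y1] /andP[z0 z1].
have c1 : 0 <= logistic b 1 - 2^-1.
  by rewrite -(logistic0 b) subr_ge0 logistic_homo.
have cc : logistic b 1 - 2^-1 <= b / 4.
  by rewrite -(logistic0 b) (le_trans (logistic_lipschitz b0 ler01))// subr0 mulr1.
have b4 : 0 <= b / 4 by rewrite divr_ge0.
have [xz|zx] := leP x z.
  have neg : (logistic b 1 - 2^-1) * (x - z) <= 0.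
    by rewrite mulr_ge0_le0// subr_le0.
  have [yx|xy] := leP y x.
    have : logistic b (y - z) <= logistic b (x - z) by apply: logistic_homo => //; lra.
    have := mulr_ge0 b4 y0; lra.
  have /(logistic_lipschitz b0) : x - z <= y - z by lra.
  have := mulr_ge0 b4 x0; lra.
have := @logistic_chord b (x - z) b0; have -> : 0 <= x - z <= 1 by lra.
move=> /(_ isT); rewrite mulrC => C.
have [yz|zy] := leP y z.
  have : logistic b (y - z) <= logistic b 0 by apply: logistic_homo => //; lra.
  rewrite logistic0; have := mulr_ge0 b4 y0; lra.
have /(logistic_lipschitz b0) : 0 <= y - z by lra.
rewrite logistic0; have := mulr_ge0 b4 z0; lra.
Qed.

(** Since [s (- z) = 1 - s z], the chord bound at [z] controls [1/2 - s (- z)]; moving from [- z] to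
    [y - z] costs at most [b / 4 * y]. *)
Lemma logistic_half_ge b y z : 0 <= b -> 0 <= y <= 1 -> 0 <= z <= 1 ->
  (logistic b 1 - 2^-1) * z - b / 4 * y <= 2^-1 - logistic b (y - z).
Proof.
move=> b0 /andP[y0 y1] z01; move: (z01) => /andP[z0 z1].
have b4 : 0 <= b / 4 by rewrite divr_ge0.
have := logistic_chord b0 z01; rewrite -[logistic b z]opprK.
have -> : - logistic b z = logistic b (- z) - 1 by rewrite logisticN; ring.
have /(logistic_lipschitz b0) : - z <= y - z by lra.
lra.
Qed.

End logistic.

(** * Plackett-Luce weights: total mass and pairwise comparisons *)

(** Splits off the value at [i0]. With [i0 = ord0] this is the choice of the top candidate followed
    by a ranking of the others, which drives the inductions below. *)
Lemma sum_lift_perm (V : nmodType) n (i0 : 'I_n.+1) (F : 'S_n.+1 -> V) :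
  \sum_(s : 'S_n.+1) F s = \sum_(j < n.+1) \sum_(s : 'S_n) F (lift_perm i0 j s).
Proof.
rewrite (partition_big (fun s : 'S_n.+1 => s i0) predT)//=.
apply: eq_bigr => j _; rewrite (reindex (lift_perm i0 j)).
  by apply: eq_bigl => s; rewrite lift_perm_id eqxx.
(* Deletes position [i] and value [s i] from [s], inverting [lift_perm]. The default [k] is never
   reached, as [s (lift i k) != s i]. *)
pose ulsf i (s : 'S_n.+1) k := odflt k (unlift (s i) (s (lift i k))).
have ulsfK i (s : 'S_n.+1) k : lift (s i) (ulsf i s k) = s (lift i k).
  rewrite /ulsf; have := neq_lift i k.
  by rewrite -(can_eq (permK s)) => /unlift_some[] ? ? ->.
have inj_ulsf : injective (ulsf i0 _).
  move=> s; apply: can_inj (ulsf (s i0) s^-1%g) _ => k'.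
  by rewrite {1}/ulsf ulsfK !permK liftK.
exists (fun s => perm (inj_ulsf s)) => [s _|s].
  by apply/permP=> k'; rewrite permE /ulsf lift_perm_lift lift_perm_id liftK.
move/(s _ =P _) => si0; apply/permP=> k.
case: (unliftP i0 k) => [k'|] ->; rewrite ?lift_perm_id//.
by rewrite lift_perm_lift -si0 permE ulsfK.
Qed.

Section plackett_luce_weights.
Context {R : realFieldType}.

(** General weights replace the exponentials so that the family is stable under removal of a
    candidate. *)
Definition pl_weight m (w : 'I_m -> R) (s : 'S_m) : R :=
  \prod_(k < m) (w (s k) / \sum_(c : 'I_m | (k <= rank_of s c)%N) w c).

Lemma rank_of_lift n (i : 'I_n.+1) (s : 'S_n) (c : 'I_n) :
  rank_of (lift_perm ord0 i s) (lift i c) = lift ord0 (rank_of s c).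
Proof. by rewrite /rank_of lift_permV lift_perm_lift. Qed.

Lemma rank_of_lift_id n (i : 'I_n.+1) (s : 'S_n) :
  rank_of (lift_perm ord0 i s) i = ord0.
Proof. by rewrite /rank_of lift_permV lift_perm_id. Qed.

Lemma sum_lift n (i : 'I_n.+1) (P : pred 'I_n.+1) (w : 'I_n.+1 -> R) :
  \sum_(c | P c) w c = (if P i then w i else 0) + \sum_(c | P (lift i c)) w (lift i c).
Proof.
rewrite big_mkcond (bigD1_ord i)//=; congr (_ + _).
by rewrite [RHS]big_mkcond.
Qed.

(** The sequential nature of the model: once [i] is on top, the rest follows the same model with the
    weights restricted to the other candidates. *)
Lemma pl_weight_lift n (w : 'I_n.+1 -> R) i (s : 'S_n) :
  pl_weight w (lift_perm ord0 i s) =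
  w i / (\sum_c w c) * pl_weight (w \o lift i) s.
Proof.
rewrite /pl_weight big_ord_recl lift_perm_id; congr (_ * _).
apply: eq_bigr => k _; rewrite lift_perm_lift; congr (_ / _).
rewrite (sum_lift i) rank_of_lift_id /= add0r.
by apply: eq_bigl => c; rewrite rank_of_lift.
Qed.

Lemma pl_weight_ge0 m (w : 'I_m -> R) s : (forall c, 0 < w c) -> 0 <= pl_weight w s.
Proof.
by move=> w0; apply: prodr_ge0 => k _; rewrite divr_ge0 ?sumr_ge0// => *; exact: ltW.
Qed.

Lemma sumr_ord_gt0 n (w : 'I_n.+1 -> R) : (forall c, 0 < w c) -> 0 < \sum_c w c.
Proof.
move=> w0; rewrite big_ord_recl ltr_pwDl//.
by apply: sumr_ge0 => *; exact: ltW.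
Qed.

Lemma sum_pl_weight m (w : 'I_m -> R) : (forall c, 0 < w c) ->
  \sum_(s : 'S_m) pl_weight w s = 1.
Proof.
elim: m w => [|n IH] w w0.
  rewrite (big_pred1 1%g) => [|s]; first by rewrite /pl_weight big_ord0.
  by apply/esym/eqP/permP => -[].
rewrite (sum_lift_perm ord0).
under eq_bigr => i _.
  under eq_bigr do rewrite pl_weight_lift.
  rewrite -mulr_sumr IH => [|c /=]; last exact: w0.
  over.
by rewrite -!mulr_suml mulr1 mulfV// gt_eqF// sumr_ord_gt0.
Qed.

(** Condition on the top candidate [i]. For [i = j] the event is sure, for [i = j'] impossible, and
    otherwise induction gives the same ratio, as [w j] and [w j'] survive the restriction. With
    total weight [W] and [r = w j / (w j + w j')], this amounts to
    [w j / W + (W - w j - w j') / W * r = r]. *)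
Lemma sum_pl_weight_above m (w : 'I_m -> R) j j' : (forall c, 0 < w c) -> j != j' ->
  \sum_(s : 'S_m | ranks_above s j j') pl_weight w s = w j / (w j + w j').
Proof.
elim: m w j j' => [|n IH] w j j' w0 jj'; first by case: j jj'.
rewrite big_mkcond/= (sum_lift_perm ord0).
have j'j : j' != j by rewrite eq_sym.
have W0 : 0 < \sum_c w c by exact: sumr_ord_gt0.
have first i : \sum_(s : 'S_n) (if ranks_above (lift_perm ord0 i s) j j'
      then pl_weight w (lift_perm ord0 i s) else 0) =
    w i / (\sum_c w c) *
    (if i == j then 1 else if i == j' then 0 else w j / (w j + w j')).
  under eq_bigr do rewrite pl_weight_lift.
  case: (unliftP i j) jj' => [k ->|->] jj'.
    rewrite (negbTE (neq_lift _ _)).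
    case: (unliftP i j') jj' => [k' ->|->] jj'.
      rewrite (negbTE (neq_lift _ _)).
      rewrite -(IH (w \o lift i) k k') ?mulr_sumr//=.
      - rewrite [RHS]big_mkcond/=; apply: eq_bigr => s _.
        by rewrite /ranks_above !rank_of_lift.
      - by rewrite -(inj_eq (@lift_inj _ i)).
    rewrite eqxx mulr0 big1// => s _.
    by rewrite /ranks_above rank_of_lift_id.
  rewrite eqxx mulr1.
  case: (unliftP i j') jj' => [k' ->|->]; last by rewrite eqxx.
  (* With [j] on top every ranking of the others counts, so a factor 1 is expanded as their total
     weight. *)
  move=> _; rewrite -[RHS]mulr1 -(sum_pl_weight (w := w \o lift i)) => [|c]; last exact: w0.
  rewrite mulr_sumr; apply: eq_bigr => s _.
  by rewrite /ranks_above rank_of_lift_id rank_of_lift.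
under eq_bigr do rewrite first.
have Wdef : \sum_(i | (i != j) && (i != j')) w i = \sum_c w c - w j - w j'.
  rewrite [in RHS](bigD1 j)//= [\sum_(i | i != j) w i](bigD1 j')//=; ring.
move: (\sum_c w c) W0 Wdef {first} => W W0 Wdef.
rewrite (bigD1 j)//= eqxx mulr1 (bigD1 j')//= (negbTE j'j) eqxx mulr0 add0r.
rewrite (eq_bigr (fun i => w i / W * (w j / (w j + w j')))); last first.
  by move=> i /andP[/negbTE -> /negbTE ->].
rewrite -!mulr_suml.
rewrite Wdef.
field; by rewrite !gt_eqF// addr_gt0.
Qed.

End plackett_luce_weights.

(** * Moments of sums of independent centred variables on a finite product *)

Section product_weights.
Context {R : realType} {J : finType} {n : nat}.
Variable q : 'I_n -> J -> R.
Hypothesis q_ge0 : forall i j, 0 <= q i j.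
Hypothesis q_sum1 : forall i, \sum_j q i j = 1.

Let Q (P : n.-tuple J) : R := \prod_(i < n) q i (tnth P i).

Lemma sum_tuple_prod (F : 'I_n -> J -> R) :
  \sum_(P : n.-tuple J) \prod_(i < n) F i (tnth P i) = \prod_(i < n) \sum_j F i j.
Proof.
rewrite bigA_distr_bigA/= (reindex (@finfun_of_tuple J n)).
  by apply: eq_bigr => P _; apply: eq_bigr => i _; rewrite ffunE.
exists (@tuple_of_finfun J n) => P _; first exact: finfun_of_tupleK.
exact: tuple_of_finfunK.
Qed.

Lemma prod_weight_ge0 P : 0 <= Q P.
Proof. exact: prodr_ge0. Qed.

Lemma sum_prod_weight : \sum_P Q P = 1.
Proof. by rewrite /Q sum_tuple_prod big1. Qed.

Variable h : 'I_n -> J -> R.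
Hypothesis h_centered : forall i, \sum_j q i j * h i j = 0.

Lemma covariance_prod_weight i1 i2 : i1 != i2 ->
  \sum_P Q P * (h i1 (tnth P i1) * h i2 (tnth P i2)) = 0.
Proof.
move=> ii.
(* [F] puts both factors inside the product, so that the sum over tuples factorizes; the factor at
   [i1] is the vanishing mean of [h i1]. *)
pose F i j := q i j * (if i == i1 then h i j else 1) * (if i == i2 then h i j else 1).
rewrite (eq_bigr (fun P => \prod_(i < n) F i (tnth P i))) => [|P _]; last first.
  rewrite /F !big_split/= -big_mkcond/= -[in RHS]big_mkcond/= !big_pred1_eq.
  by rewrite mulrA.
rewrite sum_tuple_prod (bigD1 i1)//=.
rewrite [X in X * _](_ : _ = 0) ?mul0r// -[RHS](h_centered i1).
by apply: eq_bigr => j _; rewrite /F eqxx (negbTE ii) mulr1.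
Qed.

Variable K : R.
Hypothesis h_bounded : forall i j, `|h i j| <= K.

(** Cross terms vanish by independence, leaving [n] diagonal terms of at most [K ^+ 2] each. *)
Lemma second_moment_prod_weight :
  \sum_P Q P * (\sum_(i < n) h i (tnth P i)) ^+ 2 <= n%:R * K ^+ 2.
Proof.
have -> : \sum_P Q P * (\sum_(i < n) h i (tnth P i)) ^+ 2 =
    \sum_(i < n) \sum_P Q P * (h i (tnth P i) ^+ 2).
  rewrite exchange_big/=.
  rewrite (eq_bigr (fun P => \sum_(i1 < n) \sum_(i2 < n)
      Q P * (h i1 (tnth P i1) * h i2 (tnth P i2)))) => [|P _]; last first.
    by rewrite expr2 mulr_suml mulr_sumr; apply: eq_bigr => i _; rewrite !mulr_sumr.
  rewrite [RHS]exchange_big/= exchange_big/=; apply: eq_bigr => i1 _.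
  rewrite exchange_big/= (bigD1 i1)//= [X in _ + X]big1 ?addr0 => [|i2 ii].
    by apply: eq_bigr => P _; rewrite expr2.
  by apply: covariance_prod_weight; rewrite eq_sym.
apply: (@le_trans _ _ (\sum_(i < n) K ^+ 2)); last first.
  by rewrite sumr_const card_ord mulr_natl.
apply: ler_sum => i _.
rewrite -[leRHS]mul1r -sum_prod_weight mulr_suml.
apply: ler_sum => P _; rewrite ler_wpM2l ?prod_weight_ge0//.
rewrite -[leLHS]ger0_norm ?sqr_ge0// normrX lerXn2r ?nnegrE ?normr_ge0//.
exact: le_trans (normr_ge0 _) (h_bounded i (tnth P i)).
Qed.

(* AM-GM: [|x| <= (x^2 / l + l) / 2] with [l = K sqrt n]. *)
Lemma first_moment_prod_weight : (0 < n)%N -> 0 < K ->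
  \sum_P Q P * `|\sum_(i < n) h i (tnth P i)| <= K * Num.sqrt n%:R.
Proof.
move=> n0 K0; set l := _ * _.
have l0 : 0 < l by rewrite mulr_gt0// sqrtr_gt0 ltr0n.
have l2 : n%:R * K ^+ 2 = l ^+ 2 by rewrite exprMn sqr_sqrtr ?ler0n// mulrC.
apply: (@le_trans _ _ (\sum_P Q P *
    (((\sum_(i < n) h i (tnth P i)) ^+ 2 / l + l) / 2))).
  apply: ler_sum => P _; rewrite ler_wpM2l ?prod_weight_ge0//.
  move: (\sum_(i < n) _) => x.
  rewrite -real_normK ?num_real// -subr_ge0.
  rewrite [leRHS](_ : _ = (`|x| - l) ^+ 2 / (2 * l)); last by field; rewrite gt_eqF.
  by rewrite divr_ge0 ?sqr_ge0// mulr_ge0// ltW.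
under eq_bigr do rewrite mulrA mulrDr mulrA.
rewrite -mulr_suml big_split/= -!mulr_suml sum_prod_weight mul1r.
rewrite ler_pdivrMr// mulr_natr mulr2n lerD2r ler_pdivrMr//.
by rewrite -expr2 -l2 second_moment_prod_weight.
Qed.

End product_weights.

(** * From a nearly maximal expected score to a utility bound *)

Section deterministic.
Context {R : realType} {n m : nat}.
Variables (b : R) (u : 'I_n -> 'I_m -> R).
Hypothesis b_ge0 : 0 <= b.
Hypothesis u01 : forall i j, 0 <= u i j <= 1.

(* The term [k = j] adds 1/2 per voter to the expected Borda score. *)
Definition expected_score j : R := \sum_(i < n) \sum_(k < m) logistic b (u i j - u i k).

(** Each voter contributes [m^2 / 2], since [s x + s (- x) = 1]; the average expected score is thus
    [n m / 2]. *)
Lemma sum_expected_score : \sum_(j < m) expected_score j = n%:R * (m%:R * m%:R * 2^-1).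
Proof.
rewrite /expected_score exchange_big/=.
have E i : \sum_(j < m) \sum_(k < m) logistic b (u i j - u i k) = m%:R * m%:R * 2^-1.
  set S := LHS.
  have : S + S = m%:R * m%:R.
    rewrite {2}/S exchange_big/= /S -big_split/=.
    under eq_bigr => j _.
      rewrite -big_split/=.
      under eq_bigr => k _ do rewrite -[u i k - _]opprB logisticN addrC subrK.
      rewrite sumr_const card_ord.
      over.
    by rewrite sumr_const card_ord mulr_natr.
  by move=> <-; field.
under eq_bigr do rewrite E.
by rewrite sumr_const card_ord [RHS]mulr_natl.
Qed.

(** The slack [D] allows for a winner that maximizes the expected score only approximately. It
    enters twice, through the comparison with [j] and through that with the average candidate. *)
Lemma near_max_score_utility (w : 'I_m) (D : R) :
  (forall j, expected_score j <= expected_score w + D) -> forall j,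
  m%:R * ((logistic b 1 - 2^-1) * \sum_(i < n) u i j) <=
  m%:R * (b / 2 * \sum_(i < n) u i w) + 2 * D.
Proof.
move=> H j; set c := _ - 2^-1.
have H1 : \sum_(i < n) \sum_(k < m) (c * (u i j - u i k) - b / 4 * u i w) <= D.
  apply: le_trans (_ : expected_score j - expected_score w <= _); last by rewrite lerBlDl.
  rewrite /expected_score -sumrB; apply: ler_sum => i _.
  rewrite -sumrB; apply: ler_sum => k _.
  exact: logistic_sub_ge.
(* The average expected score [n m / 2] exceeds that of [w] by at most [D]. *)
have H2 : \sum_(i < n) \sum_(k < m) (c * u i k - b / 4 * u i w) <= D.
  apply: le_trans (_ : \sum_(i < n) \sum_(k < m)
    (2^-1 - logistic b (u i w - u i k)) <= _).
    by apply: ler_sum => i _; apply: ler_sum => k _; apply: logistic_half_ge.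
  under eq_bigr do rewrite sumrB.
  rewrite sumrB -/(expected_score w) !sumr_const !card_ord -mulrnA.
  have m0 : (0 : R) < m%:R by rewrite ltr0n; exact: leq_ltn_trans (leq0n w) (ltn_ord w).
  rewrite -(ler_pM2l m0).
  have : \sum_(k < m) expected_score k <= \sum_(k < m) (expected_score w + D).
    by apply: ler_sum => k _.
  rewrite sum_expected_score sumr_const card_ord -[2^-1 *+ _]mulr_natr -[(_ + D) *+ _]mulr_natr natrM.
  move: (expected_score w) (n%:R : R) (m%:R : R) => M n' m' e; lra.
(* In the sum of the two bounds the terms in [u i k] cancel. *)
have := lerD H1 H2; rewrite -big_split/=.
under eq_bigr => i _.
  rewrite -big_split/=.
  rewrite (eq_bigr (fun=> c * u i j - b / 2 * u i w)) => [|k _]; last by field.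
  rewrite sumr_const card_ord -[_ *+ m]mulr_natl.
  over.
rewrite -mulr_sumr sumrB -!mulr_sumr.
move: (\sum_(i < n) u i j) (\sum_(i < n) u i w) (m%:R : R) => X Y m' e; lra.
Qed.

End deterministic.

(** * The Borda winner for fixed utilities *)

Section borda_pointwise.
Context {R : realType} {m : nat}.
Implicit Types (beta : R) (u : m.-tuple R).

Lemma plackett_luce_ge0 beta u s : 0 <= plackett_luce beta u s.
Proof.
by apply: (@pl_weight_ge0 _ _ (fun c => expR (beta * tnth u c))) => c; exact: expR_gt0.
Qed.

Lemma sum_plackett_luce beta u : \sum_s plackett_luce beta u s = 1.
Proof.
by apply: (@sum_pl_weight _ _ (fun c => expR (beta * tnth u c))) => c; exact: expR_gt0.
Qed.

Lemma sum_plackett_luce_above beta u j k : j != k ->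
  \sum_(s | ranks_above s j k) plackett_luce beta u s =
  logistic beta (tnth u j - tnth u k).
Proof.
move=> jk; rewrite (@sum_pl_weight_above _ _ (fun c => expR (beta * tnth u c)))//; last first.
  by move=> c; exact: expR_gt0.
rewrite /logistic mulrBr opprB expRD expRN.
have := expR_gt0 (beta * tnth u j); have := expR_gt0 (beta * tnth u k).
move: (expR _) (expR _) => x y x0 y0.
by field; rewrite !gt_eqF// addr_gt0.
Qed.

(** Contribution of one ranking to the score of [j], minus its mean given the utilities. *)
Definition score_deviation beta u (j : 'I_m) (s : 'S_m) : R :=
  \sum_(k < m | k != j)
    ((ranks_above s j k)%:R - logistic beta (tnth u j - tnth u k)).

Lemma score_deviation_centered beta u j :
  \sum_s plackett_luce beta u s * score_deviation beta u j s = 0.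
Proof.
rewrite /score_deviation; under eq_bigr do rewrite mulr_sumr.
rewrite exchange_big/= big1// => k kj.
under eq_bigr do rewrite mulrBr.
rewrite sumrB -mulr_suml sum_plackett_luce mul1r.
rewrite -sum_plackett_luce_above 1?eq_sym// [X in _ - X]big_mkcond/=.
rewrite -sumrB big1// => s _.
by case: ifP => _; rewrite ?mulr1 ?mulr0 subrr.
Qed.

Lemma score_deviation_le beta u j s : `|score_deviation beta u j s| <= m%:R.
Proof.
apply: (le_trans (ler_norm_sum _ _ _)); rewrite big_mkcond/=.
apply: (@le_trans _ _ (\sum_(k < m) 1)); last by rewrite sumr_const card_ord.
apply: ler_sum => k _; case: ifP => // _.
set x := tnth u j - tnth u k.
have := logistic_gt0 beta x; have := logistic_lt1 beta x.
by rewrite ler_norml; case: ranks_above => /=; lra.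
Qed.

Context {n : nat}.
Implicit Types (us : n.-tuple (m.-tuple R)) (P : n.-tuple 'S_m).

Lemma profile_prob_ge0 beta us P : 0 <= profile_prob beta us P.
Proof. by apply: prodr_ge0 => i _; exact: plackett_luce_ge0. Qed.

Lemma sum_profile_prob beta us : \sum_P profile_prob beta us P = 1.
Proof.
exact: (sum_prod_weight (q := fun i => plackett_luce beta (tnth us i))
  (fun i => sum_plackett_luce beta (tnth us i))).
Qed.

(** The subtracted [n / 2] is the diagonal term [k = j], which [expected_score] counts and the Borda
    score does not. *)
Lemma borda_scoreE beta us P j : (0 < n)%N ->
  borda_score R P j =
  expected_score beta (fun i => tnth (tnth us i)) j - n%:R / 2 +
  \sum_(i < n) score_deviation beta (tnth us i) j (tnth P i).
Proof.
move=> n0.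
have n1 : (n%:R : R) != 0 by rewrite pnatr_eq0 -lt0n.
have -> : n%:R / 2 = \sum_(i < n) logistic beta (tnth (tnth us i) j - tnth (tnth us i) j).
  rewrite (eq_bigr (fun=> 2^-1)) => [|i _]; last by rewrite subrr logistic0.
  by rewrite sumr_const card_ord mulr_natl.
rewrite /expected_score -sumrB -big_split/=.
rewrite /borda_score /fraction_above -mulr_suml mulrC divfK//.
rewrite (eq_bigr (fun k => \sum_(i < n) (ranks_above (tnth P i) j k)%:R)); last first.
  move=> k _; rewrite -sum1_card natr_sum big_mkcond/=.
  by apply: eq_bigr => i _; rewrite inE; case: ranks_above.
rewrite exchange_big/=; apply: eq_bigr => i _.
rewrite [X in _ = X - _ + _](bigD1 j)//= [_ + _ - _]addrAC subrr add0r.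
rewrite /score_deviation -big_split/=; apply: eq_bigr => k _.
by rewrite addrC subrK.
Qed.

(** Every profile satisfies the deterministic bound with a slack given by its deviations. Averaging
    over profiles makes the error at most [4 m^2 sqrt n], and division by [n m] leaves
    [4 m / sqrt n]. *)
Lemma borda_utility_ge beta us (t : @tie_breaking m) j : (0 < n)%N -> 0 <= beta ->
  valid_tie_breaking t -> (forall i k, 0 <= tnth (tnth us i) k <= 1) ->
  (logistic beta 1 - 2^-1) * (n%:R^-1 * \sum_(i < n) tnth (tnth us i) j) <=
  beta / 2 * (\sum_P profile_prob beta us P *
    \sum_(k < m) borda R t P k * (n%:R^-1 * \sum_(i < n) tnth (tnth us i) k)) +
  4 * m%:R / Num.sqrt n%:R.
Proof.
move=> n0 b0 ht u01.
have m0 : (0 : R) < m%:R by rewrite ltr0n (leq_ltn_trans (leq0n j) (ltn_ord j)).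
have n1 : (0 : R) < n%:R by rewrite ltr0n.
pose w P := t n P (borda_winners R P).
pose X k := \sum_(i < n) tnth (tnth us i) k.
pose Dev k P := `|\sum_(i < n) score_deviation beta (tnth us i) k (tnth P i)|.
have wP P k : borda_score R P k <= borda_score R P (w P).
  have : w P \in borda_winners R P.
    apply: ht; apply/set0Pn.
    case: (@arg_maxP _ _ _ j predT (borda_score R P)) => // i _ hi.
    by exists i; rewrite inE; apply/forallP => k'; exact: hi.
  by rewrite inE => /forallP.
have key P : m%:R * ((logistic beta 1 - 2^-1) * X j) <=
    m%:R * (beta / 2 * X (w P)) + 4 * \sum_(k < m) Dev k P.
  (* The scores of [k] and of the winner each deviate by at most the sum over all candidates, whence
     the factor 2. Taking the whole sum avoids deviations indexed by the random winner. *)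
  have near k : expected_score beta (fun i => tnth (tnth us i)) k <=
      expected_score beta (fun i => tnth (tnth us i)) (w P) + 2 * \sum_(k < m) Dev k P.
    have DP k' : Dev k' P <= \sum_(k < m) Dev k P.
      by rewrite (bigD1 k')//= lerDl sumr_ge0// => *; exact: normr_ge0.
    have := wP P k; rewrite !(borda_scoreE beta us)//.
    have := DP k; have := DP (w P); rewrite {1 3}/Dev => /ler_normlP[d1 d2] /ler_normlP[d3 d4].
    lra.
  have := near_max_score_utility b0 u01 near j; rewrite -/(X j) -/(X (w P)); lra.
(* Independence of the rankings given the utilities enters here, with [K = m]. *)
have dev k : \sum_P profile_prob beta us P * Dev k P <= m%:R * Num.sqrt n%:R.
  exact: (first_moment_prod_weight (fun i => plackett_luce_ge0 beta (tnth us i))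
    (fun i => sum_plackett_luce beta (tnth us i))
    (fun i => score_deviation_centered beta (tnth us i) k)
    (fun i => score_deviation_le beta (tnth us i) k) n0 m0).
have inner P : \sum_(k < m) borda R t P k * (n%:R^-1 * X k) = n%:R^-1 * X (w P).
  rewrite (bigD1 (w P))//= eqxx mul1r big1 ?addr0// => k /negbTE kw.
  by rewrite /borda /= -/(w P) kw mul0r.
under [X in _ <= _ * X + _]eq_bigr do rewrite inner.
have avg : m%:R * ((logistic beta 1 - 2^-1) * X j) <=
    m%:R * (beta / 2 * \sum_P profile_prob beta us P * X (w P)) +
    4 * (m%:R * (m%:R * Num.sqrt n%:R)).
  apply: (@le_trans _ _ (\sum_P profile_prob beta us P *
      (m%:R * (beta / 2 * X (w P)) + 4 * \sum_(k < m) Dev k P))).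
    rewrite -[leLHS]mul1r -[X in X * _ <= _](sum_profile_prob beta us) mulr_suml.
    by apply: ler_sum => P _; rewrite ler_wpM2l ?profile_prob_ge0.
  under eq_bigr do rewrite mulrDr.
  rewrite big_split/= lerD//.
    rewrite !mulr_sumr; apply: ler_sum => P _.
    by rewrite le_eqVlt; apply/orP; left; apply/eqP; ring.
  under eq_bigr do rewrite mulrCA.
  rewrite -mulr_sumr ler_wpM2l//.
  under eq_bigr do rewrite mulr_sumr.
  rewrite exchange_big/=.
  apply: (@le_trans _ _ (\sum_(k < m) m%:R * Num.sqrt n%:R)).
    by apply: ler_sum => k _; exact: dev.
  by rewrite sumr_const card_ord [leRHS]mulr_natl.
have -> : \sum_P profile_prob beta us P * (n%:R^-1 * X (w P)) =
    n%:R^-1 * \sum_P profile_prob beta us P * X (w P).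
  by rewrite mulr_sumr; apply: eq_bigr => P _; rewrite mulrCA.
have -> : 4 * m%:R / Num.sqrt n%:R = n%:R^-1 * (4 * (m%:R * Num.sqrt n%:R)) :> R.
  have s0 : 0 < Num.sqrt (n%:R : R) by rewrite sqrtr_gt0.
  rewrite -[in n%:R^-1](@sqr_sqrtr _ n%:R) ?ltW//; field.
  by rewrite gt_eqF.
rewrite -/(X j) mulrCA [beta / 2 * (_ * _)]mulrCA -mulrDr ler_pM2l ?invr_gt0//.
rewrite -(ler_pM2l m0) (le_trans avg)// le_eqVlt; apply/orP; left; apply/eqP; ring.
Qed.

End borda_pointwise.

(** * Marginals of the i.i.d. law *)

Section iid_marginals.
Context {d : measure_display} {T : measurableType d} {R : realType}.
Variable V : probability T R.

Lemma iidS n (B : set (n.+1.-tuple T)) :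
  iid V n.+1 B = (V \x iid V n)%E (@tuple_cons d T n @^-1` B).
Proof. by []. Qed.

Lemma iid_rect n (A : set T) (B : set (n.-tuple T)) :
  measurable A -> measurable B -> (V \x iid V n)%E (A `*` B) = (V A * iid V n B)%E.
Proof. by move=> mA mB; exact: product_measure1E. Qed.

Lemma iid_marginal n (i : 'I_n) (A : set T) : measurable A ->
  iid V n [set us | A (tnth us i)] = V A.
Proof.
move=> mA; elim: n i => [[]//|n IH] i; rewrite iidS.
have mB (k : 'I_n) : measurable [set us : n.-tuple T | A (tnth us k)].
  by rewrite -[X in measurable X]setTI; exact: measurable_tnth.
case: (unliftP ord0 i) => [k|] ->.
  rewrite (_ : _ @^-1` _ = setT `*` [set us : n.-tuple T | A (tnth us k)]).
    by rewrite iid_rect// probability_setT mul1e IH.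
  by apply/seteqP; split=> -[x us] /=; rewrite tnthS => //; case.
rewrite (_ : _ @^-1` _ = A `*` setT).
  by rewrite iid_rect// probability_setT mule1.
by apply/seteqP; split=> -[x us] /=; rewrite tnth0 => //; case.
Qed.

Lemma measurable_iid_forall n (A : set T) : measurable A ->
  measurable [set us : n.-tuple T | forall i, A (tnth us i)].
Proof.
move=> mA; rewrite (_ : mkset _ =
    \bigcap_(i in [set: 'I_n]) ((fun us : n.-tuple T => tnth us i) @^-1` A)).
  apply: fin_bigcap_measurable => // i _.
  by rewrite -[X in measurable X]setTI; exact: measurable_tnth.
by apply/seteqP; split=> us H i => [_|]; [exact: (H i)|exact: (H i I)].
Qed.

Lemma iid_forall n (A : set T) : measurable A -> V A = 1%E ->
  iid V n [set us | forall i, A (tnth us i)] = 1%E.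
Proof.
move=> mA VA; elim: n => [|n IH].
  by rewrite /= diracE mem_set// => -[].
rewrite iidS (_ : _ @^-1` _ = A `*` [set us : n.-tuple T | forall i, A (tnth us i)]).
  by rewrite iid_rect// ?VA ?IH ?mule1//; exact: measurable_iid_forall.
apply/seteqP; split=> -[x us] /=.
  by move=> H; split=> [|i]; [have := H ord0|have := H (lift ord0 i); rewrite tnthS].
move=> [Ax Aus] i; case: (unliftP ord0 i) => [k|] ->; first by rewrite tnthS.
by rewrite tnth0.
Qed.

Lemma ge0_integral_iid_marginal n (i : 'I_n) (f : T -> \bar R) :
  measurable_fun setT f -> (forall x, 0 <= f x)%E ->
  (\int[iid V n]_us f (tnth us i) = \int[V]_x f x)%E.
Proof.
move=> mf f0.
transitivity (\int[pushforward (iid V n) (fun us : n.-tuple T => tnth us i)]_x f x)%E.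
  rewrite ge0_integral_pushforward//; exact: measurable_tnth.
apply: eq_measure_integral => [|mt A mA _]; first exact: measurable_tnth.
exact: (iid_marginal i mA).
Qed.

End iid_marginals.

(** * Integrals on sets of full measure, upper limits and ratios *)

(** Utilities lie in the unit interval only almost surely; this confines integrals to the cube,
    where the integrands are nonnegative. *)
Lemma integral_probability1 d (T : measurableType d) (R : realType)
    (P : probability T R) (A : set T) (f : T -> \bar R) :
  measurable A -> P A = 1%E -> measurable_fun setT f ->
  (\int[P]_x f x = \int[P]_(x in A) f x)%E.
Proof.
move=> mA PA mf; rewrite [RHS]integral_mkcond; apply: ae_eq_integral => //.
  by apply/(measurable_restrictT f mA); exact: measurable_funTS.
exists (~` A); split; [exact: measurableC|by have := probability_setC P mA; rewrite PA subee//|].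
move=> x /= H Ax; apply: H => _; by rewrite patchE mem_set.
Qed.

Lemma limn_esup_le_near (R : realType) (u : (\bar R)^nat) (l : \bar R) :
  (\forall n \near \oo, u n <= l)%E -> (limn_esup u <= l)%E.
Proof.
move=> ul; rewrite /limn_esup /limf_esup.
(* The upper limit is an infimum over the sets of the filter, and the set where the bound holds is
   one of them. *)
apply: (@le_trans _ _ (ereal_sup (u @` [set n | (u n <= l)%E]))).
  by apply: ereal_inf_lbound; exists [set n | (u n <= l)%E].
by apply: ge_ereal_sup => _ [n /= un <-].
Qed.

(** [1 <= C] covers the convention for [0 / 0]. Otherwise [y = 0] would force [x = 0], and [y = +oo]
    makes the quotient 0. *)
Lemma utility_ratio_le (R : realType) (x y : \bar R) (C : R) : 1 <= C ->
  (0 <= x)%E -> (0 <= y)%E -> (x <= C%:E * y)%E -> (utility_ratio x y <= C%:E)%E.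
Proof.
move=> C1 x0 y0 xy; have C0 : 0 < C by exact: lt_le_trans C1.
rewrite /utility_ratio; case: ifPn => [_|nz]; first by rewrite lee_fin.
case: y y0 xy nz => [y| |]//.
- rewrite lee_fin le_eqVlt => /predU1P[<-|y0] xy nz.
    by move: xy nz; rewrite mule0 => xy; rewrite (le_anti (_ : x <= 0 <= x)%E) ?eqxx// xy.
  by rewrite inver gt_eqF// lee_pdivrMr.
- by move=> _ _ _; rewrite invey mule0 lee_fin ltW.
Qed.

Lemma near_const_div_sqrt_le (R : realType) (a k : R) : 0 < k ->
  \forall n \near \oo, (0 < n)%N /\ a / Num.sqrt n%:R <= k.
Proof.
move=> k0; near=> n.
have n0 : (0 < n)%N by near: n; exact: nbhs_infty_gt.
have s0 : 0 < Num.sqrt (n%:R : R) by rewrite sqrtr_gt0 ltr0n.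
split=> //; rewrite ler_pdivrMr// -ler_pdivrMl//.
apply: (le_trans (ler_norm _)); rewrite -sqrtr_sqr ler_wsqrtr//.
near: n; exact: nbhs_infty_ger.
Unshelve. all: end_near. Qed.

(** * Integration over the utilities *)

Section borda_expectation.
Context {R : realType} {m : nat}.
Implicit Types (V : probability (m.-tuple R) R).

Lemma measurable_plackett_luce (beta : R) (s : 'S_m) :
  measurable_fun setT (fun u : m.-tuple R => plackett_luce beta u s).
Proof.
have mw c : measurable_fun setT (fun u : m.-tuple R => expR (beta * tnth u c)).
  apply: measurableT_comp; first exact: measurable_expR.
  apply: measurable_funM; first exact: measurable_cst.
  exact: measurable_tnth.
rewrite /plackett_luce; apply: measurable_prod => k _.
apply: measurable_funM; first exact: mw.
have mS : measurable_fun setT (fun u : m.-tuple R =>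
    \sum_(c : 'I_m | (k <= rank_of s c)%N) expR (beta * tnth u c)).
  under eq_fun do rewrite -big_filter.
  by apply: measurable_sum => c; exact: mw.
(* Inversion is handled as the power [-1], which agrees with it on nonnegative reals. *)
have := measurableT_comp (measurable_powR (-1)) mS.
congr (measurable_fun _ _); apply/funext => u /=.
by rewrite powR_inv1// sumr_ge0// => c _; exact: expR_ge0.
Qed.

Definition expected_utility (beta : R) (f : voting_rule R m) n
    (us : n.-tuple (m.-tuple R)) : R :=
  \sum_(P : n.-tuple 'S_m) profile_prob beta us P *
    \sum_(j < m) f n P j * (n%:R^-1 * \sum_(i < n) tnth (tnth us i) j).

Lemma measurable_mean_utility n (j : 'I_m) :
  measurable_fun setT (fun us : n.-tuple (m.-tuple R) =>
    n%:R^-1 * \sum_(i < n) tnth (tnth us i) j).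
Proof.
apply: measurable_funM; first exact: measurable_cst.
apply: measurable_sum => i.
apply: (@measurableT_comp _ _ _ _ _ _ (fun u : m.-tuple R => tnth u j) _
  (fun us : n.-tuple (m.-tuple R) => tnth us i)); exact: measurable_tnth.
Qed.

Lemma measurable_expected_utility beta f n :
  measurable_fun setT (@expected_utility beta f n).
Proof.
apply: measurable_sum => P; apply: measurable_funM.
  apply: measurable_prod => i _.
  apply: (@measurableT_comp _ _ _ _ _ _
    (fun u : m.-tuple R => plackett_luce beta u (tnth P i)) _
    (fun us : n.-tuple (m.-tuple R) => tnth us i)); last exact: measurable_tnth.
  exact: measurable_plackett_luce.
apply: measurable_sum => j; apply: measurable_funM; first exact: measurable_cst.
exact: measurable_mean_utility.
Qed.

Definition unit_cube : set (m.-tuple R) := [set u | forall j, 0 <= tnth u j <= 1].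

Lemma measurable_unit_cube : measurable unit_cube.
Proof.
rewrite (_ : unit_cube = [set u | forall j, `[0, 1]%classic (tnth u j)]).
  by apply: measurable_iid_forall; exact: measurable_itv.
by apply/seteqP; split=> u H j; have := H j; rewrite /= in_itv.
Qed.

Lemma measurable_EFin_tnth (j : 'I_m) (D : set (m.-tuple R)) :
  measurable_fun D (fun u : m.-tuple R => (tnth u j)%:E).
Proof. by apply: measurable_funTS; apply/measurable_EFinP; exact: measurable_tnth. Qed.

Lemma Util_unit_cube V j : utility_distribution V ->
  Util V j = (\int[V]_(u in unit_cube) (tnth u j)%:E)%E.
Proof.
move=> V1; rewrite /Util unlock.
apply: integral_probability1 => //; first exact: measurable_unit_cube.
exact: measurable_EFin_tnth.
Qed.

Lemma Util_ge0 V j : utility_distribution V -> (0 <= Util V j)%E.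
Proof.
move=> V1; rewrite Util_unit_cube//; apply: integral_ge0 => u /(_ j).
by rewrite lee_fin => /andP[].
Qed.

Lemma Util_le1 V j : utility_distribution V -> (Util V j <= 1)%E.
Proof.
move=> V1; rewrite Util_unit_cube//.
apply: (@le_trans _ _ (\int[V]_(u in unit_cube) (cst 1 u))%E).
  apply: ge0_le_integral => //; first exact: measurable_unit_cube.
  - by move=> u /(_ j)/andP[]; rewrite lee_fin.
  - exact: measurable_EFin_tnth.
  - by move=> u /(_ j)/andP[]; rewrite lee_fin.
rewrite integral_cst; last exact: measurable_unit_cube.
by rewrite mul1e [leLHS](V1 : V unit_cube = 1%E).
Qed.

Definition unit_cubes n : set (n.-tuple (m.-tuple R)) :=
  [set us | forall i, unit_cube (tnth us i)].

Lemma measurable_unit_cubes n : measurable (@unit_cubes n).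
Proof. by apply: measurable_iid_forall; exact: measurable_unit_cube. Qed.

Lemma iid_unit_cubes V n : utility_distribution V -> iid V n (@unit_cubes n) = 1%E.
Proof. by move=> V1; apply: iid_forall => //; exact: measurable_unit_cube. Qed.

Lemma integral_iid_utility V n (i : 'I_n) j : utility_distribution V ->
  (\int[iid V n]_(us in @unit_cubes n) (tnth (tnth us i) j)%:E)%E = Util V j.
Proof.
(* Truncation at 0 makes the coordinate nonnegative everywhere, as the change of variables demands,
   and changes nothing on the cube. *)
move=> V1; pose f (u : m.-tuple R) : \bar R := (Num.max 0 (tnth u j))%:E.
have mf : measurable_fun setT f.
  apply/measurable_EFinP; apply: measurable_maxr; first exact: measurable_cst.
  exact: measurable_tnth.
have fE u : unit_cube u -> f u = (tnth u j)%:E.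
  by move=> /(_ j)/andP[u0 _]; rewrite /f max_r.
transitivity (\int[iid V n]_us f (tnth us i))%E.
  rewrite (integral_probability1 (@measurable_unit_cubes n) (iid_unit_cubes n V1)).
    by apply: eq_integral => us; rewrite inE => /(_ i)/fE.
  apply: (@measurableT_comp _ _ _ _ _ _ f _
    (fun us : n.-tuple (m.-tuple R) => tnth us i)) => //; exact: measurable_tnth.
rewrite ge0_integral_iid_marginal//.
  rewrite (integral_probability1 measurable_unit_cube V1 mf) Util_unit_cube//.
  by apply: eq_integral => u; rewrite inE => /fE.
by move=> u; rewrite lee_fin le_max lexx.
Qed.

Lemma Util_rule_unit_cubes beta V f n : utility_distribution V ->
  Util_rule beta V f n =
  (\int[iid V n]_(us in @unit_cubes n) (expected_utility beta f us)%:E)%E.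
Proof.
move=> V1; rewrite /Util_rule unlock.
apply: integral_probability1; [exact: measurable_unit_cubes|exact: iid_unit_cubes|].
by apply/measurable_EFinP; exact: measurable_expected_utility.
Qed.

Lemma mean_utility_ge0 n (us : n.-tuple (m.-tuple R)) j : unit_cubes us ->
  0 <= n%:R^-1 * \sum_(i < n) tnth (tnth us i) j.
Proof.
move=> H; rewrite mulr_ge0 ?invr_ge0// sumr_ge0// => i _.
by have /andP[] := H i j.
Qed.

Lemma expected_utility_ge0 beta f n (us : n.-tuple (m.-tuple R)) : unit_cubes us ->
  0 <= expected_utility beta f us.
Proof.
move=> H; apply: sumr_ge0 => P _; rewrite mulr_ge0 ?profile_prob_ge0//.
by apply: sumr_ge0 => j _; rewrite mulr_ge0 ?lottery_ge0 ?mean_utility_ge0.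
Qed.

Lemma Util_rule_ge0 beta V f n : utility_distribution V -> (0 <= Util_rule beta V f n)%E.
Proof.
move=> V1; rewrite Util_rule_unit_cubes//; apply: integral_ge0 => us H.
by rewrite lee_fin expected_utility_ge0.
Qed.

Lemma integral_mean_utility V n j : (0 < n)%N -> utility_distribution V ->
  (\int[iid V n]_(us in @unit_cubes n)
    (n%:R^-1 * \sum_(i < n) tnth (tnth us i) j)%:E)%E = Util V j.
Proof.
move=> n0 V1; have mG := @measurable_unit_cubes n.
have mt i : measurable_fun (@unit_cubes n)
    (fun us : n.-tuple (m.-tuple R) => (tnth (tnth us i) j)%:E).
  apply: measurable_funTS; apply: (@measurableT_comp _ _ _ _ _ _
    (fun u : m.-tuple R => (tnth u j)%:E) _
    (fun us : n.-tuple (m.-tuple R) => tnth us i)); last exact: measurable_tnth.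
  exact: measurable_EFin_tnth.
have t0 i us : @unit_cubes n us -> (0 <= (tnth (tnth us i) j)%:E)%E.
  by move=> /(_ i j)/andP[]; rewrite lee_fin.
under eq_integral do rewrite EFinM -sumEFin.
rewrite ge0_integralZl//.
- rewrite ge0_integral_sum//.
  under eq_bigr do rewrite integral_iid_utility//.
  (* [Util V j] lies between 0 and 1, hence is real, so that [n] copies of it divided by [n]
     simplify. *)
  have : (0 <= Util V j)%E by exact: Util_ge0.
  have := Util_le1 j V1; case: (Util V j) => [r| |]//= _ _.
  rewrite sumEFin sumr_const card_ord -EFinM -[r *+ n]mulr_natl mulKf//.
  by rewrite pnatr_eq0 -lt0n.
- by apply: emeasurable_sum.
- by move=> us H; apply: sume_ge0 => i _; exact: t0.
Qed.

(** Integrates the pointwise bound over the cubes; the error stays the same because it is constant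
    and the law has mass 1. *)
Lemma Util_le_Util_borda beta V (t : @tie_breaking m) n j :
  (0 < n)%N -> 0 <= beta -> valid_tie_breaking t -> utility_distribution V ->
  ((logistic beta 1 - 2^-1)%:E * Util V j <=
   (beta / 2)%:E * Util_rule beta V (borda R t) n +
   (4 * m%:R / Num.sqrt n%:R)%:E)%E.
Proof.
move=> n0 b0 ht V1; have mG := @measurable_unit_cubes n.
have b2 : 0 <= beta / 2 by rewrite divr_ge0.
have c0 : 0 <= logistic beta 1 - 2^-1.
  by rewrite -(logistic0 beta) subr_ge0 logistic_homo.
have e0 : 0 <= 4 * m%:R / Num.sqrt n%:R :> R.
  by rewrite divr_ge0 ?sqrtr_ge0// mulr_ge0.
rewrite Util_rule_unit_cubes// -(integral_mean_utility j n0 V1).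
have mX : measurable_fun (@unit_cubes n) (fun us : n.-tuple (m.-tuple R) =>
    (n%:R^-1 * \sum_(i < n) tnth (tnth us i) j)%:E).
  by apply: measurable_funTS; apply/measurable_EFinP; exact: measurable_mean_utility.
have mU : measurable_fun (@unit_cubes n)
    (fun us => (expected_utility beta (borda R t) us)%:E).
  by apply: measurable_funTS; apply/measurable_EFinP; exact: measurable_expected_utility.
rewrite -!ge0_integralZl//; last first.
- by move=> us H; rewrite lee_fin mean_utility_ge0.
- by move=> us H; rewrite lee_fin expected_utility_ge0.
have -> : (4 * m%:R / Num.sqrt n%:R)%:E =
    (\int[iid V n]_(us in @unit_cubes n) cst (4 * m%:R / Num.sqrt n%:R)%:E us)%E.
  by rewrite integral_cst// [X in (_ * X)%E](iid_unit_cubes n V1) mule1.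
rewrite -ge0_integralD//=; last 2 first.
- by move=> us H; rewrite -EFinM lee_fin mulr_ge0// expected_utility_ge0.
- exact: measurable_funeM.
apply: ge0_le_integral => //.
- by move=> us H; rewrite -EFinM lee_fin mulr_ge0// mean_utility_ge0.
- exact: measurable_funeM.
- by apply: emeasurable_funD => //; exact: measurable_funeM.
- move=> us H; rewrite -!EFinM -EFinD lee_fin.
  exact: borda_utility_ge.
Qed.

End borda_expectation.

(** * The distortion bound *)

(** This is the constant [c1], equal to [tanh (beta / 2) / 2]; dividing [beta / 2] by it yields the
    claimed bound. *)
Lemma logistic1_half (R : realType) (beta : R) :
  logistic beta 1 - 2^-1 = (1 - expR (- beta)) / (2 * (1 + expR (- beta))).
Proof.
rewrite /logistic mulr1; have := expR_gt0 (- beta).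
by move: (expR _) => e e0; field; rewrite gt_eqF// addr_gt0.
Qed.

Theorem theorem7p1 (R : realType) (m : nat) (beta : R) (t : @tie_breaking m) :
  (2 <= m)%N -> 1 <= beta -> valid_tie_breaking t ->
  (distortion beta (borda R t) <=
    (beta * ((1 + expR (- beta)) / (1 - expR (- beta))))%:E)%E.
Proof.
move=> m2 b1 ht; set rho := beta * _.
have b0 : 0 <= beta by exact: le_trans b1.
have e0 := expR_gt0 (- beta).
have e1 : 0 < 1 - expR (- beta) by rewrite subr_gt0 expR_lt1 oppr_lt0 (lt_le_trans ltr01).
have c0 : 0 < logistic beta 1 - 2^-1.
  by rewrite logistic1_half divr_gt0// mulr_gt0// addr_gt0.
have rhoE : rho * (logistic beta 1 - 2^-1) = beta / 2.
  rewrite logistic1_half /rho; move: (expR _) e0 e1 => e e0 e1.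
  by field; rewrite !gt_eqF// addr_gt0.
have rho1 : 1 <= rho.
  apply: (le_trans b1); rewrite ler_peMr// ler_pdivlMr// mul1r; lra.
apply: ge_ereal_sup => _ [V V1 <-].
(* The error term vanishes only in the limit, so a margin [d] is granted to absorb it for large
   [n]. *)
apply/lee_addgt0Pr => d d0; rewrite -EFinD.
apply: limn_esup_le_near.
have [j _ Umax] := eq_bigmax (Ordinal (ltnW m2)) predT (Util V) isT
  (fun i _ => leNye (Util V i)).
rewrite Umax.
have U0 := Util_ge0 j V1; have U1 := Util_le1 j V1.
have Uborda n (n0 : (0 < n)%N) := Util_le_Util_borda j n0 b0 ht V1.
case: (Util V j) U0 U1 Uborda => [r| |]//; rewrite !lee_fin => r0 r1 Uborda.
have C1 : 1 <= rho + d by rewrite (le_trans rho1)// lerDl ltW.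
(* If the largest utility is 0, the error has nothing to be absorbed into, but the ratio bound is
   then immediate for every [n]. *)
move: r0; rewrite le_eqVlt => /predU1P[r0|r0].
  apply: nearW => n; apply: utility_ratio_le => //.
  - by rewrite -r0.
  - exact: Util_rule_ge0.
  - by rewrite -r0 mule_ge0 ?Util_rule_ge0// lee_fin (le_trans ler01).
(* With an error of at most [k], the bound [c1 r <= rho c1 y + k] rearranges to [r <= (rho + d) y],
   since [c1 r - k = c1 r rho / (rho + d)]. *)
pose k := d * ((logistic beta 1 - 2^-1) * r) / (rho + d).
have C0 : 0 < rho + d by exact: lt_le_trans C1.
have k0 : 0 < k by rewrite divr_gt0// !mulr_gt0.
apply: filterS (near_const_div_sqrt_le (4 * m%:R) k0) => n [n0 nk].
apply: utility_ratio_le => //; [exact: ltW|exact: Util_rule_ge0|].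
have := Uborda n n0; have := Util_rule_ge0 beta (borda R t) n V1.
case: (Util_rule _ _ _ _) => [y| |]//.
  rewrite -!EFinM -EFinD !lee_fin => y0 H.
  have b2 : 0 < beta / 2 by rewrite divr_gt0// (lt_le_trans ltr01).
  rewrite -(ler_pM2l b2) -rhoE.
  move: H nk; rewrite /k ler_pdivlMr// -rhoE.
  move: (_ / _) (logistic _ _ - _) c0 => e c c0 H nk.
  have := ler_wpM2r (ltW C0) H; nra.
by move=> _ _; rewrite gt0_muley ?leey// lte_fin.
Qed.
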